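(* Let $m$ be a positive integer and let $\Sigma_d$ be a positive discrete-time semi-Markovian jump linear system such that the expected value $E[F_k^{[m]}\mid\sigma_k=i,\sigma_{k+1}=j]$ exists for all $i,j\in\{1,\dots,N\}$. Let $\mathcal F_m\in\mathbb R^{(n_mN)\times(n_mN)}$ be the block matrix whose $(i,j)$-block is $[\mathcal F_m]_{ij}=p_{ji}E[F_k^{[m]}\mid\sigma_k=j,\sigma_{k+1}=i]\in\mathbb R^{n_m\times n_m}$, and let $\zeta(k)=e_{\sigma_k}$. Then the matrix $\mathcal F_m$ is (entrywise) nonnegative. Moreover, for every $k\ge0$, $$E\big[\zeta(k+1)\otimes x_d(k+1)^{[m]}\big]=\mathcal F_m\,E\big[\zeta(k)\otimes x_d(k)^{[m]}\big].$$
   Context: Setting. On a probability space $(\Omega,\mathcal M,P)$ let $\{\sigma_k\}_{k\ge0}$ be a time-homogeneous Markov chain in $\{1,\dots,N\}$ with transition matrix $[p_{ij}]$ and constant $\sigma_0$, and let $\{F_k\}_{k\ge0}$ be a stochastic process in $\mathbb R^{n\times n}$. $\Sigma_d$ is the system $x_d(k+1)=F_kx_d(k)$, $x_d(0)=x_0$, with constant $x_0\in\mathbb R^n$. It is a discrete-time semi-Markovian jump linear system if for all $k\ge0$, $i,j\in\{1,\dots,N\}$ and Borel $B\subset\mathbb R^{n\times n}$: (1) $P(\sigma_{k+1}=j,F_k\in B\mid\sigma_k,\dots,\sigma_0,F_{k-1},\dots,F_0)=P(\sigma_{k+1}=j,F_k\in B\mid\sigma_k)$; (2) $P(\sigma_{k+1}=j,F_k\in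 B\mid\sigma_k=i)$ does not depend on $k$ (this transition law is regarded as given for every $i$). It is positive if each $F_k$ is entrywise nonnegative with probability 1. The conditional expectations in $\mathcal F_m$ do not depend on $k$, and a block with $p_{ji}=0$ is $0$. Notation. $e_i$ is the $i$-th standard unit vector of $\mathbb R^N$; $\otimes$ is the Kronecker product. $n_m=\binom{n+m-1}{m}$. For $x\in\mathbb R^n$, $x^{[m]}\in\mathbb R^{n_m}$ is the vector of all lexicographically ordered degree-$m$ monomials in $x_1,\dots,x_n$, with positive coefficients chosen so that $\|x\|_2^m=\|x^{[m]}\|_2$ (the coefficient of $x_1^{a_1}\cdots x_n^{a_n}$ is $\sqrt{m!/(a_1!\cdots a_n!)}$). For $A\in\mathbb R^{n\times n}$, $A^{[m]}\in\mathbb R^{n_m\times n_m}$ is the unique matrix with $(Ax)^{[m]}=A^{[m]}x^{[m]}$ for all $x\in\mathbb R^n$.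
   Formalization: Positivity is also required under the given transition law from every state, including states the chain never visits; without this the blocks of F_m for such states could have negative entries. *)

(* Defs.v *)
From HB Require Import structures.
From mathcomp Require Import all_boot all_order all_algebra.
From mathcomp Require Import mxtens.
From mathcomp Require Import all_classical all_reals all_analysis.

Set Implicit Arguments.
Unset Strict Implicit.
Unset Printing Implicit Defensive.

Import Order.TTheory GRing.Theory Num.Theory.
Import numFieldNormedType.Exports.

Local Open Scope classical_set_scope.
Local Open Scope ring_scope.

(* The exponent vectors of length n and total degree m. They come in decreasing
   lexicographic order, i.e. x_1^m is the first monomial and x_n^m the last. *)
Fixpoint expvecs (n m : nat) : seq (seq nat) :=
  if n is n'.+1 then
    flatten [seq [seq (m - k)%N :: a | a <- expvecs n' k] | k <- iota 0 m.+1]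
  else if m is 0 then [:: [::]] else [::].

Lemma expvecsS n m : expvecs n.+1 m =
  flatten [seq [seq (m - k)%N :: a | a <- expvecs n k] | k <- iota 0 m.+1].
Proof. by []. Qed.

Lemma mem_expvecs n m a :
  (a \in expvecs n m) = (size a == n) && (sumn a == m).
Proof.
elim: n m a => [|n IHn] m a.
  by case: m => [|m]; case: a => [|x a] //=; rewrite inE.
rewrite expvecsS; apply/flatten_mapP/idP => [[k]|].
  rewrite mem_iota add0n ltnS /= => lekm /mapP[b].
  rewrite IHn => /andP[/eqP sb /eqP kb] -> /=.
  by rewrite sb kb subnK ?eqxx.
case: a => [//|x a]; rewrite [size _]/= [sumn _]/= eqSS => /andP[] sa /eqP xam.
exists (sumn a).
  by rewrite mem_iota add0n ltnS -xam leq_addl.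
by apply/mapP; exists a; rewrite ?IHn ?sa ?eqxx // -xam addnK.
Qed.

Lemma sorted_expvecs n m :
  pairwise (fun s t : seqlexi nat => (t < s)%O) (expvecs n m).
Proof.
elim: n m => [|n IHn] m; first by case: m.
rewrite expvecsS.
have : pairwise ltn (iota 0 m.+1).
  by rewrite -sorted_pairwise ?iota_ltn_sorted //; exact: ltn_trans.
have : all (fun k => (k <= m)%N) (iota 0 m.+1).
  by apply/allP => k; rewrite mem_iota add0n ltnS.
elim: (iota 0 m.+1) => [//|k s IHs] /= /andP[km sm] /andP[ks ps].
rewrite pairwise_cat IHs // andbT; apply/andP; split; last first.
  rewrite pairwise_map; apply: sub_pairwise (IHn k) => a b.
  by rewrite /= ltxi_cons /= lexx.
apply/allrelP => a b /mapP[a' _ ->] /flatten_mapP[l ls /mapP[b' _ ->]].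
have kl : (k < l)%N by exact: (allP ks).
have lm : (l <= m)%N by exact: (allP sm).
have lkm : (m - l < m - k)%N by rewrite ltn_sub2l // (leq_trans kl).
by rewrite ltxi_cons leEnat ltnW //= leqNgt lkm.
Qed.

Definition powdim (n m : nat) : nat := 'C(n + m - 1, m).

Lemma size_expvecs n m : size (expvecs n m) = powdim n m.
Proof.
case: n => [|n].
  rewrite /powdim add0n; case: m => [|m] //=.
  by rewrite subn1 bin_small.
rewrite /powdim addSn subn1 [_.-1]/=.
elim: n m => [|n IHn] m;
  rewrite expvecsS size_flatten /shape -map_comp sumnE big_map
    -[iota 0 m.+1]/(index_iota 0 m.+1).
  by rewrite add0n binn big_nat_recl // big1_seq.
rewrite (eq_bigr (fun k => 'C(n + k, k))); last first.
  by move=> k _; rewrite /comp size_map IHn.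
elim: m => [|m IHm]; first by rewrite big_nat1 !bin0.
by rewrite big_nat_recr //= IHm [in RHS]addSn binS addSnnS addnC.
Qed.

Section SymmetricPower.
Context {R : realType} {n : nat} (m : nat).

(* x^[m] *)
Definition sympow (x : 'cV[R]_n) : 'cV[R]_(powdim n m) :=
  \col_(i < powdim n m)
    let a := nth [::] (expvecs n m) i in
    Num.sqrt (m`!%:R / (\prod_(l < n) (nth 0%N a l)`!)%:R)
      * \prod_(l < n) x l 0 ^+ nth 0%N a l.

(* A^[m]: the matrix B such that (A x)^[m] = B x^[m] for all x. *)
Definition sympow_mx (A : 'M[R]_n) : 'M[R]_(powdim n m) :=
  xget 0 [set B | forall x : 'cV[R]_n, sympow (A *m x) = B *m sympow x].

End SymmetricPower.

(* n x n real matrices with their Borel sigma-algebra *)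
Definition borelM (R : realType) (n : nat) :=
  g_sigma_algebraType (@open ('M[R]_n)).
HB.instance Definition _ (R : realType) (n : nat) :=
  Measurable.on (borelM R n).

Definition mx_nonneg {R : realType} {p q : nat} (A : 'M[R]_(p, q)) : Prop :=
  forall i j, 0 <= A i j.

Section Probability.
Context {d : measure_display} {T : measurableType d} {R : realType}.
Variable P : probability T R.

Definition cond_pr (A B : set T) : R := fine (P (A `&` B)) / fine (P B).

(* Y is a version of the conditional probability of the event E given the
   sub-sigma-algebra G. *)
Definition is_cond_pr (G : set (set T)) (E : set T) (Y : T -> R) : Prop :=
  [/\ forall B : set R, measurable B -> G (Y @^-1` B),
      P.-integrable setT (EFin \o Y) &
      forall A, G A -> (\int[P]_(w in A) (Y w)%:E)%E = P (A `&` E)].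

Definition mx_integrable {p q : nat} (X : T -> 'M[R]_(p, q)) (A : set T) :=
  forall a b, P.-integrable A (fun w => (X w a b)%:E).

Definition mx_expectation {p q : nat} (X : T -> 'M[R]_(p, q)) : 'M[R]_(p, q) :=
  \matrix_(a, b) fine ('E_P[fun w => X w a b])%E.

(* E[X | A] for an event A of positive probability *)
Definition mx_cond_expectation {p q : nat} (X : T -> 'M[R]_(p, q))
    (A : set T) : 'M[R]_(p, q) :=
  \matrix_(a, b) (fine (\int[P]_(w in A) (X w a b)%:E)%E / fine (P A)).

End Probability.

Section SemiMarkov.
Context {d : measure_display} {T : measurableType d} {R : realType}.
Variable P : probability T R.
Context {N n : nat}.
Variables (p : 'M[R]_N) (s0 : 'I_N) (x0 : 'cV[R]_n).
Variables (sigma : nat -> T -> 'I_N) (F : nat -> T -> 'M[R]_n).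

(* The transition law: law i j B is the probability that sigma_(k+1) = j and
   F_k \in B given sigma_k = i. It is a datum for every i, also for the states
   that the chain started at s0 never visits. *)
Variable law : 'I_N -> 'I_N -> {measure set (borelM R n) -> \bar R}.

Definition mode (k : nat) (i : 'I_N) : set T := [set w | sigma k w = i].

Record markov_chain : Prop := MarkovChain {
  mc_meas : forall k i, measurable (mode k i);
  mc_ge0 : mx_nonneg p;
  mc_sum1 : forall i, \sum_j p i j = 1;
  mc_init : forall w, sigma 0%N w = s0;
  mc_step : forall k (s : nat -> 'I_N) j,
    let past := [set w | forall l, (l <= k)%N -> sigma l w = s l] in
    P past != 0%E -> cond_pr P (mode k.+1 j) past = p (s k) j
}.

Definition sigma_present (k : nat) : set (set T) :=
  <<s [set A | exists i, A = mode k i] >>.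

(* sigma-algebra generated by sigma_0, ..., sigma_k, F_0, ..., F_(k-1) *)
Definition sigma_past (k : nat) : set (set T) :=
  <<s [set A | (exists l i, (l <= k)%N /\ A = mode l i) \/
               (exists l (B : set (borelM R n)),
                  [/\ (l < k)%N, measurable B & A = F l @^-1` B])] >>.

(* In sm_markov, the equality of two conditional probabilities given
   sigma-algebras is the existence of a common version. *)
Record semi_markov_jump_system : Prop := SemiMarkovJumpSystem {
  sm_chain : markov_chain;
  sm_meas : forall k, measurable_fun setT (F k : T -> borelM R n);
  sm_markov : forall k j (B : set (borelM R n)), measurable B ->
    let E := mode k.+1 j `&` F k @^-1` B in
    exists2 Y : T -> R, is_cond_pr P (sigma_present k) E Y
                      & is_cond_pr P (sigma_past k) E Y;
  sm_law : forall k i j (B : set (borelM R n)), measurable B ->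
    P (mode k i) != 0%E ->
    (cond_pr P (mode k.+1 j `&` F k @^-1` B) (mode k i))%:E = law i j B;
  sm_law_setT : forall i j, law i j setT = (p i j)%:E
}.

(* F_k >= 0 almost surely, and likewise under the transition law from any
   state; the second clause only matters for states that are never visited. *)
Definition positive_system : Prop :=
  (forall k, {ae P, forall w, mx_nonneg (F k w)}) /\
  (forall i j, {ae law i j, forall A, mx_nonneg (A : 'M[R]_n)}).

Fixpoint trajectory (k : nat) (w : T) : 'cV[R]_n :=
  if k is l.+1 then F l w *m trajectory l w else x0.

Definition jump (k : nat) (i j : 'I_N) : set T := mode k i `&` mode k.+1 j.

Variable m : nat.

(* E[F_k^[m] | sigma_k = i, sigma_(k+1) = j]; if the conditioning event is
   null, the conditional law of F_k is the normalized transition law. *)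
Definition mean_power (k : nat) (i j : 'I_N) : 'M[R]_(powdim n m) :=
  if P (jump k i j) == 0%E then
    \matrix_(a, b)
      (fine (\int[law i j]_A (sympow_mx m (A : 'M[R]_n) a b)%:E)%E / p i j)
  else mx_cond_expectation P (fun w => sympow_mx m (F k w)) (jump k i j).

Definition mean_power_exists (k : nat) (i j : 'I_N) : Prop :=
  if P (jump k i j) == 0%E then
    forall a b, (law i j).-integrable setT
      (fun A => (sympow_mx m (A : 'M[R]_n) a b)%:E)
  else mx_integrable P (fun w => sympow_mx m (F k w)) (jump k i j).

(* The matrix \mathcal F_m, with the conditional expectations taken at time k *)
Definition moment_mx (k : nat) : 'M[R]_(N * powdim n m) :=
  \matrix_(r, c)
    let: (i, a) := mxtens_unindex r in
    let: (j, b) := mxtens_unindex c in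
    (p j i *: mean_power k j i) a b.

(* zeta(k) (x) x_d(k)^[m] *)
Definition lifted_state (k : nat) (w : T) : 'M[R]_(N * powdim n m, 1 * 1) :=
  tensmx (delta_mx (sigma k w) 0 : 'cV[R]_N) (sympow m (trajectory k w)).

End SemiMarkov.

(* Main.v *)
Require Import Defs.
From mathcomp Require Import all_boot all_order all_algebra.
From mathcomp Require Import mxtens.
From mathcomp Require Import all_classical all_reals all_analysis.
From mathcomp Require Import measurable_realfun.

Set Implicit Arguments.
Unset Strict Implicit.
Unset Printing Implicit Defensive.

Import Order.TTheory GRing.Theory Num.Theory.
Import numFieldNormedType.Exports.

Local Open Scope classical_set_scope.
Local Open Scope ring_scope.

(** Split the lifted state by modes: its block i at time k is
    1_(sigma_k = i) x_d(k)^[m]. Since x_d(k+1) = F_k x_d(k), block i at time k+1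
    is the sum over j of 1_(sigma_k = j, sigma_(k+1) = i) F_k^[m] x_d(k)^[m].
    The semi-Markov property says that, on the event sigma_k = j, the pair
    (sigma_(k+1), F_k) is independent of the past and has law the transition
    law, while x_d(k) is a function of the past. The expectation of each summand
    is therefore (the integral of A^[m] against law j i) times
    E[1_(sigma_k = j) x_d(k)^[m]], and the first factor is
    p_ji E[F_k^[m] | sigma_k = j, sigma_(k+1) = i], which is block (i, j) of the
    moment matrix at any time. Integrability propagates along the same
    factorization, since the existence of the conditional expectations makes
    A^[m] integrable against the transition law.

    Three ingredients carry this out.

    - [sympow_mxE] computes A^[m]: its entries are polynomials in the entries of
      A with nonnegative coefficients. This makes A^[m] a measurable function of
      A, and a nonnegative matrix when A is one; the transition law charges
      nonnegative matrices only, so the moment matrix is nonnegative. The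
      formula comes from expanding the monomials of A x over words in the
      indices; it determines A^[m] because distinct monomials are linearly
      independent ([monomials_free]).

    - [law_factor] is the independence statement: for an event A of the past,
      P(A, sigma_k = i, sigma_(k+1) = j, F_k in B)
        = P(A, sigma_k = i) law i j B.
      A version of the conditional probability that depends on sigma_k only is
      constant on the event sigma_k = i, so it comes out of the integral that
      defines it.

    - [integral_mul_indep] turns such a product formula for probabilities of
      rectangles into one for integrals, by uniqueness of the product measure
      and Fubini's theorem. *)

(** * Integrals of products under independence *)

(** The hypothesis on rectangles identifies the image of Q under (f, h) with the
    product measure, and Fubini's theorem applies there. *)
Lemma integral_mul_indep (R : realType) (d d1 d2 : measure_display)
    (Om : measurableType d) (X : measurableType d1) (Y : measurableType d2)
    (Q : {measure set Om -> \bar R})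
    (mu : {finite_measure set X -> \bar R})
    (nu : {finite_measure set Y -> \bar R})
    (f : Om -> X) (h : Om -> Y) (phi : X -> R) (psi : Y -> R) :
  measurable_fun setT f -> measurable_fun setT h ->
  (forall A B, measurable A -> measurable B ->
     Q (f @^-1` A `&` h @^-1` B) = (mu A * nu B)%E) ->
  mu.-integrable setT (EFin \o phi) -> nu.-integrable setT (EFin \o psi) ->
  Q.-integrable setT (fun w => (phi (f w) * psi (h w))%:E) /\
  (\int[Q]_w (phi (f w) * psi (h w))%:E =
   \int[mu]_x (phi x)%:E * \int[nu]_y (psi y)%:E)%E.
Proof.
move=> mf mh Qfh iphi ipsi.
have mphi : measurable_fun setT phi.
  by apply/measurable_EFinP; exact: measurable_int iphi.
have mpsi : measurable_fun setT psi.
  by apply/measurable_EFinP; exact: measurable_int ipsi.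
pose fh w := (f w, h w).
have mfh : measurable_fun setT fh by exact/measurable_fun_pair.
pose G (z : X * Y) := (phi z.1 * psi z.2)%:E.
have mG : measurable_fun setT G.
  apply/measurable_EFinP; apply: measurable_funM.
    exact: measurableT_comp mphi measurable_fst.
  exact: measurableT_comp mpsi measurable_snd.
have prodE (C : set (X * Y)) : measurable C ->
    (mu \x nu)%E C = pushforward Q fh C.
  by apply: product_measure_unique => // A B mA mB; exact: Qfh.
have intE (H : X * Y -> \bar R) :
    (\int[mu \x nu]_z H z = \int[pushforward Q fh]_z H z)%E.
  by apply: eq_measure_integral => C mC _; exact: prodE.
have iG : (mu \x nu)%E.-integrable setT G.
  apply/integrable12ltyP => //.
  under eq_integral => x _.
    under eq_integral => y _ do rewrite /G /= normrM EFinM.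
    rewrite ge0_integralZl //; first over; last first.
      exact/measurable_EFinP/measurableT_comp.
  rewrite /= ge0_integralZr //.
  - apply: lte_mul_pinfty.
    + by apply: integral_ge0 => x _; rewrite lee_fin.
    + apply: integrable_fin_num => //; exact: integrable_abse iphi.
    + by have /integrableP[_] := ipsi.
  - exact/measurable_EFinP/measurableT_comp.
  - by apply: integral_ge0 => x _; rewrite lee_fin.
have iGQ : Q.-integrable setT (G \o fh).
  apply/integrableP; split; first exact: measurableT_comp mG mfh.
  have /integrableP[_] := iG.
  rewrite intE ge0_integral_pushforward //.
  exact: measurableT_comp.
split; first exact: iGQ.
rewrite -[LHS]/(\int[Q]_(w in fh @^-1` setT) (G \o fh) w)%E.
rewrite -integral_pushforward // -intE -integral12_prod_meas1 //.
rewrite /fubini_F.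
under eq_integral => x _.
  rewrite /G; under eq_integral => y _ do rewrite /= EFinM.
  rewrite integralZl //; over.
rewrite /=.
have /fineK <- : (\int[nu]_y (psi y)%:E)%E \is a fin_num.
  by apply: integrable_fin_num.
by rewrite integralZr.
Qed.

Section Restriction.
Local Open Scope ereal_scope.
Context {d : measure_display} {T : measurableType d} {R : realType}.
Variables (mu : {measure set T -> \bar R}) (D : set T) (mD : measurable D).

Lemma integral_mrestr (f : T -> \bar R) : measurable_fun setT f ->
  \int[mrestr mu mD]_x f x = \int[mu]_(x in D) f x.
Proof.
move=> mf.
have -> : \int[mu]_(x in D) f x = \int[mrestr mu mD]_(x in D) f x.
  by apply: eq_measure_integral => A mA AD /=; rewrite /mrestr setIidl.
rewrite [RHS]integral_mkcond; apply: ae_eq_integral => //.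
  by apply/(measurable_restrictT _ mD); exact: measurable_funTS.
(* f and its restriction to D differ off D only, a null set here *)
exists (~` D); split; first exact: measurableC.
  by rewrite /= /mrestr setICl measure0.
move=> x /= fx Dx; apply: fx => _; rewrite patchE mem_set //.
Qed.

Lemma integrable_mrestr (f : T -> \bar R) : measurable_fun setT f ->
  (mrestr mu mD).-integrable setT f <-> mu.-integrable D f.
Proof.
move=> mf; have E : \int[mrestr mu mD]_x `|f x| = \int[mu]_(x in D) `|f x|.
  by rewrite integral_mrestr //; exact: measurableT_comp.
split => /integrableP[_ foo]; apply/integrableP; split=> //.
- exact: measurable_funTS.
- by rewrite -E.
- by rewrite E.
Qed.

End Restriction.

(** Conditional form: mu A stands for the conditional probability, given D', of D
    and f in A together. For a jump system D' will be the event that the current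
    mode is i, and D the jump from i to j. *)
Lemma integral_restr_mul_indep (R : realType) (d d1 : measure_display)
    (Om : measurableType d) (X : measurableType d1)
    (Q : {measure set Om -> \bar R}) (D D' : set Om)
    (mu : {measure set X -> \bar R})
    (f : Om -> X) (h : Om -> R) (phi : X -> R) :
  measurable D -> measurable D' ->
  measurable_fun setT f -> measurable_fun setT h ->
  (mu setT < +oo)%E -> (Q D' < +oo)%E ->
  (forall A B, measurable A -> measurable B ->
     Q (D `&` (f @^-1` A `&` h @^-1` B)) = (mu A * Q (D' `&` h @^-1` B))%E) ->
  mu.-integrable setT (EFin \o phi) -> Q.-integrable D' (EFin \o h) ->
  Q.-integrable D (fun w => (phi (f w) * h w)%:E) /\
  (\int[Q]_(w in D) (phi (f w) * h w)%:E =
   \int[mu]_x (phi x)%:E * \int[Q]_(w in D') (h w)%:E)%E.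
Proof.
move=> mD mD' mf mh muT QD' Qfh iphi ih.
have mphi : measurable_fun setT phi.
  by apply/measurable_EFinP; exact: measurable_int iphi.
have mEphi : measurable_fun setT (EFin \o phi) by exact/measurable_EFinP.
have mEh : measurable_fun setT (EFin \o h) by exact/measurable_EFinP.
have mprod : measurable_fun setT (fun w => (phi (f w) * h w)%:E).
  apply/measurable_EFinP; apply: measurable_funM => //.
  exact: measurableT_comp mphi mf.
unshelve epose (nu0 :=
  (pushforward (mrestr Q mD') h : {measure set R -> \bar R})).
  exact: mh.
have nuT : (nu0 setT < +oo)%E.
  by rewrite /= /pushforward preimage_setT /mrestr setTI.
have mid : measurable_fun setT (EFin : R -> \bar R) by exact/measurable_EFinP.
have ihr : (mrestr Q mD').-integrable setT (EFin \o h).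
  exact/(integrable_mrestr _ mD').
have [] := @integral_mul_indep R _ _ _ Om X R (mrestr Q mD)
  (mfrestr measurableT muT) (mfrestr measurableT nuT) f h phi id mf mh.
- move=> A B mA mB; rewrite /= /mfrestr /mrestr !setIT /= /pushforward.
  by rewrite setIC Qfh // [in RHS]setIC.
- exact/(integrable_mrestr _ measurableT).
- apply/(integrable_mrestr _ measurableT) => //.
  exact: (integrable_pushforward mh).
move=> /(integrable_mrestr _ mD) iQ; rewrite !integral_mrestr // => ->.
split; first exact: iQ.
congr (_ * _)%E; rewrite (integral_pushforward mh) //=.
exact: integral_mrestr.
Qed.

Lemma restrict_boolE (R : realType) (T : Type) (D : set T) (b : T -> bool)
    (f : T -> R) w : (forall w, D w <-> b w) ->
  ((fun w => (f w)%:E) \_ D) w = ((b w)%:R * f w)%:E.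
Proof.
move=> Db; rewrite patchE; case: ifPn => [|/negP]; rewrite in_setE => Dw.
  by rewrite ((Db w).1 Dw) mul1r.
by case: (boolP (b w)) => [/(Db w).2 //|_]; rewrite mul0r.
Qed.

(** * The symmetric power of a matrix *)

Lemma digits_inj (B n : nat) (f g : nat -> nat) :
  (forall l, f l < B)%N -> (forall l, g l < B)%N ->
  (\sum_(l < n) f l * B ^ l = \sum_(l < n) g l * B ^ l)%N ->
  forall l, (l < n)%N -> f l = g l.
Proof.
elim: n f g => [//|n IHn] f g fB gB.
have shift (h : nat -> nat) : (\sum_(l < n.+1) h l * B ^ l =
    (\sum_(l < n) h l.+1 * B ^ l) * B + h 0%N)%N.
  rewrite big_ord_recl expn0 muln1 addnC big_distrl; congr addn.
  by apply: eq_bigr => l _; rewrite expnSr mulnA.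
rewrite !shift => fg.
have B0 : (0 < B)%N by exact: leq_ltn_trans (fB 0%N).
have fg0 : f 0%N = g 0%N.
  by have := congr1 (modn^~ B) fg; rewrite !modnMDl !modn_small.
case=> [//|l]; rewrite ltnS => ln.
apply: (IHn (f \o S) (g \o S)) => //=.
by have := congr1 (divn^~ B) fg; rewrite !divnMDl // !divn_small // !addn0.
Qed.

Section SymmetricPower.
Context {R : realType} {n m : nat}.
Implicit Types (a b : 'I_(powdim n m)) (x : 'cV[R]_n) (A : 'M[R]_n)
  (g : {ffun 'I_m -> 'I_n}).

Definition expvec a : seq nat := nth [::] (expvecs n m) a.

Definition weight (a : 'I_(powdim n m)) : R :=
  Num.sqrt (m`!%:R / (\prod_(l < n) (nth 0%N (expvec a) l)`!)%:R).

Lemma expvecP a : (size (expvec a) == n) && (sumn (expvec a) == m).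
Proof. by rewrite -mem_expvecs mem_nth // size_expvecs. Qed.

Lemma expvec_inj : injective expvec.
Proof.
have uniq_expvecs : uniq (expvecs n m).
  rewrite uniq_pairwise; apply: sub_pairwise (sorted_expvecs n m) => s t /=.
  by rewrite lt_neqAle eq_sym => /andP[].
move=> a b /eqP; rewrite nth_uniq ?size_expvecs // => /eqP; exact: val_inj.
Qed.

Lemma expvec_leq a l : (nth 0 (expvec a) l <= m)%N.
Proof.
have /andP[_ /eqP <-] := expvecP a.
elim: (expvec a) l => [|k s IHs] [|l] //=; first exact: leq_addr.
exact: leq_trans (IHs l) (leq_addl _ _).
Qed.

Lemma weight_gt0 a : 0 < weight a.
Proof.
rewrite sqrtr_gt0 divr_gt0 ?ltr0n ?fact_gt0 //.
by rewrite prodn_gt0 // => l; exact: fact_gt0.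
Qed.

Lemma sympowE x a :
  sympow m x a 0 = weight a * \prod_(l < n) x l 0 ^+ nth 0%N (expvec a) l.
Proof. by rewrite mxE. Qed.

(** Kronecker substitution: putting x_l = t^((m+1)^l) sends the monomial with
    exponents a to t^(sum_l a_l (m+1)^l). All a_l are at most m, so they are
    the digits of that exponent in base m+1, and distinct monomials become
    distinct powers of t. *)
Lemma monomials_free (c : 'I_(powdim n m) -> R) :
  (forall x, \sum_a c a * \prod_(l < n) x l 0 ^+ nth 0%N (expvec a) l = 0) ->
  forall a, c a = 0.
Proof.
move=> c0 a.
pose code b := (\sum_(l < n) nth 0 (expvec b) l * m.+1 ^ l)%N.
have code_inj : injective code.
  move=> b b' /digits_inj eqb; apply: expvec_inj.
  have /andP[/eqP sb _] := expvecP b; have /andP[/eqP sb' _] := expvecP b'.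
  apply: (@eq_from_nth _ 0%N); rewrite sb ?sb' // => l ln.
  by apply: eqb => // k; rewrite ltnS expvec_leq.
pose q : {poly R} := \sum_b c b *: 'X^(code b).
have q0 : q = 0.
  apply/eqP; apply: contraT => qN0.
  (* every natural number is a root, and size q of them are too many *)
  pose rs : seq R := [seq i%:R | i <- iota 0 (size q)].
  have := @max_poly_roots _ q rs qN0.
  rewrite size_map size_iota ltnn; apply; last first.
    by rewrite map_inj_uniq ?iota_uniq // => i j /eqP; rewrite eqr_nat => /eqP.
  apply/allP => t _; apply/rootP; rewrite -[RHS](c0 (\col_l t ^+ (m.+1 ^ l))).
  rewrite horner_sum; apply: eq_bigr => b _; rewrite hornerZ hornerXn.
  rewrite /code -prodrXr; congr (_ * _); apply: eq_bigr => l _.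
  by rewrite mxE mulnC exprM.
have := congr1 (fun p : {poly R} => p`_(code a)) q0.
rewrite coef0 coef_sum (bigD1 a) //= coefZ coefXn eqxx mulr1 big1 ?addr0 //.
move=> b ba; rewrite coefZ coefXn (inj_eq code_inj) eq_sym (negbTE ba).
by rewrite mulr0.
Qed.

(** A word g in the indices stands for the monomial prod_t x_(g t); its content
    is the exponent vector of that monomial. *)
Definition content (g : {ffun 'I_m -> 'I_n}) : seq nat :=
  [seq #|[pred t | g t == l]| | l <- enum 'I_n].

Lemma nth_content g (l : 'I_n) :
  nth 0%N (content g) l = #|[pred t | g t == l]|.
Proof. by rewrite (nth_map l) ?size_enum_ord // nth_ord_enum. Qed.

Lemma content_mem g : content g \in expvecs n m.
Proof.
rewrite mem_expvecs size_map size_enum_ord eqxx /=.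
rewrite sumnE big_map big_enum /= -[eqbRHS]card_ord -sum1_card.
rewrite (partition_big g xpredT) //=; apply/eqP/eq_bigr => l _.
by rewrite -sum1_card.
Qed.

Lemma prod_content (y : 'I_n -> R) g :
  \prod_t y (g t) = \prod_(l < n) y l ^+ nth 0%N (content g) l.
Proof.
rewrite (partition_big g xpredT) //=; apply: eq_bigr => l _.
rewrite (eq_bigr (fun=> y l)) => [|t /eqP -> //].
by rewrite prodr_const nth_content.
Qed.

(** The word that lists each index l in a block of length a_l has content a. *)
Lemma content_surj a : exists g, content g == expvec a.
Proof.
have /andP[/eqP sa /eqP suma] := expvecP a.
pose s := flatten [seq nseq (nth 0%N (expvec a) l) l | l : 'I_n <- enum 'I_n].
have ss : size s == m.
  rewrite size_flatten /shape -map_comp -suma.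
  rewrite (eq_map (g := fun l : 'I_n => nth 0%N (expvec a) l)); last first.
    by move=> l /=; rewrite size_nseq.
  rewrite (map_comp (nth 0%N (expvec a))) val_enum_ord -/(mkseq _ _) -sa.
  by rewrite mkseq_nth.
exists [ffun t => tnth (Tuple ss) t]; apply/eqP/(@eq_from_nth _ 0%N).
  by rewrite size_map size_enum_ord sa.
move=> l; rewrite size_map size_enum_ord => ln.
rewrite (nth_content _ (Ordinal ln)).
transitivity (count_mem (Ordinal ln) (Tuple ss)).
  rewrite -[in RHS](map_tnth_enum (Tuple ss)) count_map cardE size_filter.
  rewrite -enumT.
  by apply: eq_count => t; rewrite /= inE ffunE.
rewrite /= count_flatten -map_comp sumnE big_map big_enum /=.
rewrite (bigD1 (Ordinal ln)) //= count_nseq /= eqxx mul1n big1 ?addn0 //.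
by move=> k kl; rewrite count_nseq /= (negbTE kl).
Qed.

Definition word a : {ffun 'I_m -> 'I_n} := xchoose (content_surj a).

Lemma content_word a : content (word a) = expvec a.
Proof. exact/eqP/(xchooseP (content_surj a)). Qed.

(** Write the monomial with exponents a as a product over the letters of
    [word a]. In that product each (A x)_l is a sum over indices; distributing
    gives a sum over words g, and grouping the words by content collects the
    monomials in x. *)
Lemma sympow_mulmx A x a : sympow m (A *m x) a 0 =
  \sum_b (weight a / weight b *
    \sum_(g | content g == expvec b) \prod_t A (word a t) (g t)) *
  sympow m x b 0.
Proof.
rewrite sympowE -content_word -prod_content.
under eq_bigr do rewrite mxE.
rewrite bigA_distr_bigA /= mulr_sumr.
have rank_lt g : (index (content g) (expvecs n m) < powdim n m)%N.
  by rewrite -size_expvecs index_mem content_mem.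
pose rank g := Ordinal (rank_lt g).
have rankE g b : (rank g == b) = (content g == expvec b).
  apply/eqP/eqP => [<-|gb].
    by rewrite /expvec nth_index ?content_mem.
  by apply: expvec_inj; rewrite -gb /expvec nth_index ?content_mem.
rewrite (partition_big rank xpredT) //=; apply: eq_bigr => b _.
rewrite sympowE mulrACA divfK ?gt_eqF ?weight_gt0 // mulr_suml mulr_sumr.
under eq_bigl do rewrite rankE.
apply: eq_bigr => g /eqP <-.
by rewrite -prod_content big_split.
Qed.

(** The expansion of (A x)^[m] provides one solution of the equation that
    defines A^[m]; linear independence of the monomials makes it the only one. *)
Lemma sympow_mxE A a b : sympow_mx m A a b = weight a / weight b *
  \sum_(g | content g == expvec b) \prod_t A (word a t) (g t).
Proof.
pose M : 'M[R]_(powdim n m) := \matrix_(a, b) (weight a / weight b *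
  \sum_(g | content g == expvec b) \prod_t A (word a t) (g t)).
suff -> : sympow_mx m A = M by rewrite mxE.
have MP x : sympow m (A *m x) = M *m sympow m x.
  apply/colP => c; rewrite sympow_mulmx [RHS]mxE.
  by apply: eq_bigr => e _; congr (_ * _); rewrite mxE.
apply: xget_unique => // M' M'P; apply/matrixP => c e.
apply/eqP; rewrite -subr_eq0 -(mulIr_eq0 _ (mulIf (lt0r_neq0 (weight_gt0 e)))).
apply/eqP; move: e; apply: monomials_free => x.
transitivity (((M' - M) *m sympow m x) c 0); last first.
  by rewrite mulmxBl -M'P MP subrr mxE.
rewrite [RHS]mxE; apply: eq_bigr => e _.
by rewrite sympowE mulrA; congr (_ * _ * _);
  rewrite [RHS]mxE [X in _ = _ + X]mxE.
Qed.

End SymmetricPower.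

Section Measurability.
Context {R : realType} {n : nat}.

Lemma measurable_entry (i j : 'I_n) :
  measurable_fun setT (fun A : borelM R n => (A : 'M[R]_n) i j).
Proof.
apply: (measurability _ (RGenOpens.measurableE R)).
move=> _ [_ [a [b ->] <-]]; rewrite setTI; apply: sub_sigma_algebra.
have /continuousP := @coord_continuous R n n i j; apply; exact: interval_open.
Qed.

Lemma measurable_sympow_mx m (a b : 'I_(powdim n m)) :
  measurable_fun setT (fun A : borelM R n => sympow_mx m (A : 'M[R]_n) a b).
Proof.
have -> : (fun A : borelM R n => sympow_mx m (A : 'M[R]_n) a b) =
    (fun A : borelM R n => weight a / weight b *
      \sum_g if content g == expvec b
              then \prod_t (A : 'M[R]_n) (word a t) (g t) else 0).
  by apply/funext => A; rewrite sympow_mxE big_mkcond.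
apply: measurable_funM => //; apply: measurable_sum => g.
case: (content g == expvec b) => //; apply: measurable_prod => t _.
exact: measurable_entry.
Qed.

Lemma sympow_mx_ge0 m (A : 'M[R]_n) : mx_nonneg A -> mx_nonneg (sympow_mx m A).
Proof.
move=> A0 a b; rewrite sympow_mxE; apply: mulr_ge0.
  by rewrite divr_ge0 // ltW // weight_gt0.
by apply: sumr_ge0 => g _; exact: prodr_ge0.
Qed.

Lemma sympow_mxP m (A : 'M[R]_n) x :
  sympow m (A *m x) = sympow_mx m A *m sympow m x.
Proof.
apply/colP => a; rewrite sympow_mulmx [RHS]mxE.
by apply: eq_bigr => b _; rewrite sympow_mxE.
Qed.

End Measurability.

(** * The trajectory as a function of the past *)

(** The measurable space T is left arbitrary so that it can also be the set of
    outcomes with the events of the past, where F_l is measurable for l < k. *)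
Lemma measurable_trajectory (R : realType) n (x0 : 'cV[R]_n) d
    (T : measurableType d) (F : nat -> T -> 'M[R]_n) k c :
  (forall l, (l < k)%N -> measurable_fun setT (F l : T -> borelM R n)) ->
  measurable_fun setT (fun w => trajectory x0 F k w c 0).
Proof.
elim: k c => [|k IHk] c mF /=; first exact: measurable_cst.
have -> : (fun w => (F k w *m trajectory x0 F k w) c 0) =
    (fun w => \sum_e F k w c e * trajectory x0 F k w e 0).
  by apply/funext => w; rewrite mxE.
apply: measurable_sum => e; apply: measurable_funM.
  exact: measurableT_comp (measurable_entry c e) (mF k (ltnSn k)).
by apply: IHk => l lk; apply: mF; exact: ltnW.
Qed.

Lemma measurable_sympow_trajectory (R : realType) n m (x0 : 'cV[R]_n) d
    (T : measurableType d) (F : nat -> T -> 'M[R]_n) k a :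
  (forall l, (l < k)%N -> measurable_fun setT (F l : T -> borelM R n)) ->
  measurable_fun setT (fun w => sympow m (trajectory x0 F k w) a 0).
Proof.
move=> mF.
have -> : (fun w => sympow m (trajectory x0 F k w) a 0) = (fun w =>
    weight a * \prod_(l < n) trajectory x0 F k w l 0 ^+ nth 0%N (expvec a) l).
  by apply/funext => w; rewrite sympowE.
apply: measurable_funM => //; apply: measurable_prod => l _.
by apply: measurable_funX; exact: measurable_trajectory.
Qed.

(** * Independence from the past and the transition law *)

Section JumpSystem.
Context {d : measure_display} {T : measurableType d} {R : realType}.
Variable P : probability T R.
Context {N n : nat}.
Variables (p : 'M[R]_N) (s0 : 'I_N) (x0 : 'cV[R]_n).
Variables (sigma : nat -> T -> 'I_N) (F : nat -> T -> 'M[R]_n).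
Variable law : 'I_N -> 'I_N -> {measure set (borelM R n) -> \bar R}.
Hypothesis hsys : semi_markov_jump_system P p s0 sigma F law.

Lemma measurable_mode k i : measurable (mode sigma k i).
Proof. by case: hsys => -[]. Qed.

Lemma measurable_jump k i j : measurable (jump sigma k i j).
Proof. by apply: measurableI; exact: measurable_mode. Qed.

(** The unions of fibres of sigma_k form a sigma-algebra, and it contains the
    generators of the present. *)
Lemma sigma_present_saturated k A : sigma_present sigma k A ->
  forall w w', sigma k w = sigma k w' -> A w -> A w'.
Proof.
pose S := [set A : set T | forall w w', sigma k w = sigma k w' -> A w -> A w'].
apply: (@smallest_sub _ _ _ S); last first.
  by move=> _ [i ->] w w' ww'; rewrite /mode /= ww'.
split=> [w w' //|B SB w w' ww' [_ Bw]|B SB w w' ww' [l _ Bw]].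
  by split=> // Bw'; apply: Bw; apply: SB Bw'.
by exists l => //; exact: SB ww' Bw.
Qed.

Lemma measurable_sigma_past k A : sigma_past sigma F k A -> measurable A.
Proof.
apply: smallest_sub; first exact: sigma_algebra_measurable.
move=> _ [[l [i [_ ->]]]|[l [B [_ mB ->]]]]; first exact: measurable_mode.
by rewrite -[X in measurable X]setTI; case: hsys => _ mF _ _ _; exact: mF.
Qed.

Lemma sigma_pastI k A i : sigma_past sigma F k A ->
  sigma_past sigma F k (A `&` mode sigma k i).
Proof.
move=> pA; apply: (@measurableI _ (g_sigma_algebraType _)) => //.
by apply: sub_sigma_algebra; left; exists k, i.
Qed.

Lemma sigma_pastT k : sigma_past sigma F k setT.
Proof. exact: (@measurableT _ (g_sigma_algebraType _)). Qed.

(** The common version Y of the two conditional probabilities is constant on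
    the event sigma_k = i, say with value y. Integrating Y over A and
    sigma_k = i shows that the left-hand side is y P(A, sigma_k = i), and the
    case of A the whole space identifies y as law i j B. When sigma_k = i is
    null both sides vanish. *)
Lemma law_factor k i j A (B : set (borelM R n)) :
  sigma_past sigma F k A -> measurable B ->
  P (A `&` (jump sigma k i j `&` F k @^-1` B)) =
  (P (A `&` mode sigma k i) * law i j B)%E.
Proof.
move=> pA mB.
have mA := measurable_sigma_past pA.
have mF : measurable (F k @^-1` B).
  by rewrite -[X in measurable X]setTI; case: hsys => _ mF _ _ _; exact: mF.
have [Pi0|Pi_neq0] := eqVneq (P (mode sigma k i)) 0%E.
  have mi := measurable_mode k i.
  rewrite (subset_measure0 _ _ _ Pi0) ?mul0e.
  - by rewrite (subset_measure0 _ _ _ Pi0) ?mul0e //; exact: measurableI.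
  - do 2! apply: measurableI => //; exact: measurable_jump.
  - exact: mi.
  - by move=> w [_ [[]]].
have [w0 w0i] : exists w, mode sigma k i w.
  apply: contrapT => nomode; move/eqP: Pi_neq0; apply.
  rewrite (_ : mode sigma k i = set0) ?measure0 //.
  by apply/seteqP; split=> // w iw; apply: nomode; exists w.
have [Y [Ypres _ _] [_ _ Yint]] := sm_markov hsys k j mB.
have Ycst w : mode sigma k i w -> Y w = Y w0.
  move=> iw; apply: (@sigma_present_saturated k (Y @^-1` [set Y w0])
    (Ypres _ (measurable_set1 _)) w0 w) => //.
  by rewrite w0i iw.
have E A' : sigma_past sigma F k A' ->
    P (A' `&` (jump sigma k i j `&` F k @^-1` B)) =
    ((Y w0)%:E * P (A' `&` mode sigma k i))%E.
  move=> pA'; have pA'i := sigma_pastI i pA'.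
  rewrite -integral_cst; last exact: measurable_sigma_past pA'i.
  rewrite /jump -[in LHS]setIA [in LHS]setIA.
  rewrite -Yint //; apply: eq_integral => w; rewrite inE => -[_ /Ycst -> //].
rewrite E // muleC; congr (_ * _)%E.
rewrite -(sm_law hsys j mB Pi_neq0) /cond_pr.
have := E setT (@sigma_pastT k); rewrite !setTI /jump => EE.
rewrite setIC setIA EE fineM ?fin_num_measure //; last exact: measurable_mode.
rewrite mulfK // fine_eq0 ?fin_num_measure //; exact: measurable_mode.
Qed.

Lemma law_setT_lty i j : (law i j setT < +oo)%E.
Proof. by rewrite (sm_law_setT hsys) ltry. Qed.

(** Independence in the form used by the recursion: h is a function of the past,
    g(F_k) is fresh randomness, and the mode at time k is all that links them. *)
Lemma integral_jump k i j (g : borelM R n -> R) (h : T -> R) :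
  (forall B, measurable B -> sigma_past sigma F k (h @^-1` B)) ->
  (law i j).-integrable setT (EFin \o g) ->
  P.-integrable (mode sigma k i) (EFin \o h) ->
  P.-integrable (jump sigma k i j) (fun w => (g (F k w) * h w)%:E) /\
  (\int[P]_(w in jump sigma k i j) (g (F k w) * h w)%:E =
   \int[law i j]_A (g A)%:E * \int[P]_(w in mode sigma k i) (h w)%:E)%E.
Proof.
move=> hpast ig ih.
apply: integral_restr_mul_indep => //.
- exact: measurable_jump.
- exact: measurable_mode.
- exact: (sm_meas hsys).
- by move=> _ B mB; rewrite setTI; apply: measurable_sigma_past (hpast _ mB).
- exact: law_setT_lty.
- by rewrite ltey_eq fin_num_measure //; exact: measurable_mode.
- move=> A B mA mB; rewrite [RHS]muleC [mode _ _ _ `&` _]setIC.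
  by rewrite -(law_factor i j (hpast B mB) mA) setIA setIC.
Qed.

(** On the jump from i to j the image of P under F_k is P(sigma_k = i) times the
    transition law, so integrability against P on the jump passes to the law as
    soon as this factor is positive. *)
Lemma integrable_law k i j (g : borelM R n -> R) :
  measurable_fun setT g -> P (mode sigma k i) != 0%E ->
  P.-integrable (jump sigma k i j) (fun w => (g (F k w))%:E) ->
  (law i j).-integrable setT (EFin \o g).
Proof.
move=> mg Pi0 /integrableP[_ gF_lty].
have mi := measurable_mode k i; have mj := measurable_jump k i j.
have mF := sm_meas hsys k.
have mEg : measurable_fun setT (EFin \o g) by exact/measurable_EFinP.
have Pi_fin : P (mode sigma k i) \is a fin_num by exact: fin_num_measure.
have Pi_gt0 : 0 < fine (P (mode sigma k i)).
  by rewrite lt_neqAle fine_ge0 // eq_sym fine_eq0 // Pi0.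
apply/integrableP; split=> //.
have E : (\int[P]_(w in jump sigma k i j) `|(g (F k w))%:E| =
    P (mode sigma k i) * \int[law i j]_A `|(g A)%:E|)%E.
  rewrite -(integral_mrestr P mj
    (f := fun w => `|(g (F k w))%:E|%E)); last first.
    apply: measurableT_comp => //; exact: measurableT_comp mEg mF.
  transitivity (
    \int[pushforward (mrestr P mj) (F k : T -> borelM R n)]_A `|(g A)%:E|)%E.
    by rewrite (ge0_integral_pushforward mF) //; exact: measurableT_comp.
  rewrite -[X in (X * _)%E](fineK Pi_fin).
  rewrite -[fine _]/((NngNum (ltW Pi_gt0))%:num) -ge0_integral_mscale //.
    apply: eq_measure_integral => B mB _.
    rewrite /= /pushforward /mrestr /mscale /= fineK // setIC.
    by have := law_factor i j (@sigma_pastT k) mB; rewrite !setTI.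
  exact: measurableT_comp.
move: gF_lty; rewrite E; apply: contraTT; rewrite -leNgt leye_eq => /eqP ->.
by rewrite gt0_muley ?ltxx // lt0e Pi0 measure_ge0.
Qed.

(** The generators of [sigma_past], named so that the past is also available as
    a measurable space. *)
Definition past_events k : set (set T) :=
  [set A | (exists l i, (l <= k)%N /\ A = mode sigma l i) \/
           (exists l (B : set (borelM R n)),
              [/\ (l < k)%N, measurable B & A = F l @^-1` B])].

Lemma sigma_past_sympow m k a (B : set R) : measurable B ->
  sigma_past sigma F k ((fun w => sympow m (trajectory x0 F k w) a 0) @^-1` B).
Proof.
move=> mB.
rewrite -[_ @^-1` B]setTI.
apply: (@measurable_sympow_trajectory _ _ m x0 _
  (g_sigma_algebraType (past_events k)) F k a) => // l lk _ C mC.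
by rewrite setTI; apply: sub_sigma_algebra; right; exists l, C.
Qed.

(** The block of the moment matrix is the integral of A^[m] against the
    transition law, hence the same at all times, even when the jump is null at
    time k and the conditional expectation is read off the law. For a jump of
    positive probability the factor P(sigma_k = i) cancels between the integral
    of F_k^[m] over the jump and the probability P(sigma_k = i) p_ij of the
    jump. *)
Lemma moment_blockE m k i j a b : mean_power_exists P sigma F law m k i j ->
  let g (A : borelM R n) := sympow_mx m (A : 'M[R]_n) a b in
  (law i j).-integrable setT (EFin \o g) /\
  (p i j *: mean_power P p sigma F law m k i j) a b =
  fine (\int[law i j]_A (g A)%:E)%E.
Proof.
move=> hex g.
have mg : measurable_fun setT g by exact: measurable_sympow_mx.
have mEg : measurable_fun setT (EFin \o g) by exact/measurable_EFinP.
have mi := measurable_mode k i; have mj := measurable_jump k i j.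
have pjump : P (jump sigma k i j) = (P (mode sigma k i) * (p i j)%:E)%E.
  have := law_factor i j (@sigma_pastT k) (@measurableT _ (borelM R n)).
  by rewrite preimage_setT setIT !setTI (sm_law_setT hsys).
rewrite !mxE /mean_power; move: hex; rewrite /mean_power_exists.
case: ifPn => [_ ilaw|Pj0 /(_ a b) ijump].
  have ig : (law i j).-integrable setT (EFin \o g) by exact: ilaw.
  split=> //; rewrite mxE.
  have [pij0|pij_neq0] := eqVneq (p i j) 0; last by rewrite mulrC divfK.
  (* the transition law has total mass p_ij, so it vanishes when p_ij does *)
  rewrite pij0 mul0r null_set_integral //.
  exact: etrans (sm_law_setT hsys i j) (congr1 EFin pij0).
move: Pj0; rewrite pjump mule_eq0 negb_or eqe => /andP[Pi0 pij0].
have ig : (law i j).-integrable setT (EFin \o g) by exact: integrable_law ijump.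
split=> //; rewrite mxE.
have [||_] := @integral_jump k i j g (fun=> 1) _ ig.
- move=> B _; rewrite preimage_cst; case: ifP => _; first exact: sigma_pastT.
  exact: (@measurable0 _ (g_sigma_algebraType (past_events k))).
- exact: finite_measure_integrable_cst.
under eq_integral do rewrite mulr1.
rewrite integral_cst // mul1e => ->.
have Pi_fin : P (mode sigma k i) \is a fin_num by exact: fin_num_measure.
rewrite pjump !fineM ?integrable_fin_num //= -mulf_div mulrC.
by rewrite mulrA divfK // divfK // fine_eq0.
Qed.

(** * The recursion for the lifted state *)

Lemma integral_law_ge0 m i j a b :
  {ae law i j, forall A, mx_nonneg (A : 'M[R]_n)} ->
  0 <= fine (\int[law i j]_A (sympow_mx m (A : 'M[R]_n) a b)%:E)%E.
Proof.
move=> nneg; apply: fine_ge0.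
have mg : measurable_fun setT
    (fun A : borelM R n => (sympow_mx m (A : 'M[R]_n) a b)%:E).
  exact: (measurable_EFinP _ _).2 (measurable_sympow_mx a b).
rewrite (ae_eq_integral (fun A : borelM R n =>
    `|(sympow_mx m (A : 'M[R]_n) a b)%:E|%E)) //.
- exact: integral_ge0.
- exact: measurableT_comp.
- have [S [mS S0 Snneg]] := nneg; exists S; split=> // A /= gA; apply: Snneg.
  by move=> A0; apply: gA => _; rewrite ger0_norm // sympow_mx_ge0.
Qed.

(** Only j = sigma_k contributes to the outer sum. *)
Lemma sympow_step m k i a w :
  (sigma k.+1 w == i)%:R * sympow m (trajectory x0 F k.+1 w) a 0 =
  \sum_j \sum_b ((sigma k w == j) && (sigma k.+1 w == i))%:R *
    (sympow_mx m (F k w) a b * sympow m (trajectory x0 F k w) b 0).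
Proof.
rewrite (bigD1 (sigma k w)) //= eqxx /= [X in _ = _ + X]big1 ?addr0.
  by rewrite sympow_mxP -mulr_sumr [in LHS]mxE.
move=> j /negbTE; rewrite eq_sym => ->; rewrite big1 // => b _.
by rewrite mul0r.
Qed.

(** Once [sympow_step] has split the state by the previous mode, each term is a
    product of a function of F_k and a function of the past on one jump, where
    [integral_jump] applies. *)
Lemma integral_sympow_step m k :
  (forall i j, mean_power_exists P sigma F law m k i j) ->
  (forall j b, P.-integrable (mode sigma k j)
     (fun w => (sympow m (trajectory x0 F k w) b 0)%:E)) ->
  forall i a,
  P.-integrable (mode sigma k.+1 i)
     (fun w => (sympow m (trajectory x0 F k.+1 w) a 0)%:E) /\
  (\int[P]_(w in mode sigma k.+1 i)
      (sympow m (trajectory x0 F k.+1 w) a 0)%:E =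
   \sum_j \sum_b \int[law j i]_A (sympow_mx m (A : 'M[R]_n) a b)%:E *
      \int[P]_(w in mode sigma k j)
         (sympow m (trajectory x0 F k w) b 0)%:E)%E.
Proof.
move=> hex ih i a.
pose G j b w : \bar R := (((sigma k w == j) && (sigma k.+1 w == i))%:R *
    (sympow_mx m (F k w) a b * sympow m (trajectory x0 F k w) b 0))%:E.
have stepE : (fun w => (sympow m (trajectory x0 F k.+1 w) a 0)%:E)
    \_ (mode sigma k.+1 i) = (fun w => \sum_j \sum_b G j b w)%E.
  apply/funext => w; rewrite (restrict_boolE (b := fun w => sigma k.+1 w == i)).
    rewrite sympow_step -sumEFin; apply: eq_bigr => j _.
    by rewrite -sumEFin.
  by move=> w'; split => /eqP.
have GP j b : P.-integrable setT (G j b) /\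
    (\int[P]_w G j b w = \int[law j i]_A (sympow_mx m (A : 'M[R]_n) a b)%:E *
      \int[P]_(w in mode sigma k j)
         (sympow m (trajectory x0 F k w) b 0)%:E)%E.
  have [ig _] := moment_blockE a b (hex j i).
  have [iG GE] := integral_jump (@sigma_past_sympow m k b) ig (ih j b).
  have jumpE : (fun w => (sympow_mx m (F k w) a b *
      sympow m (trajectory x0 F k w) b 0)%:E) \_ (jump sigma k j i) = G j b.
    apply/funext => w; rewrite (restrict_boolE
      (b := fun w => (sigma k w == j) && (sigma k.+1 w == i))) //.
    move=> w'; split=> [[/eqP -> /eqP ->] //|/andP[/eqP ? /eqP ?]//].
  split.
    by rewrite -jumpE; exact/(integrable_mkcond _ (measurable_jump k j i)).
  by rewrite -GE [RHS]integral_mkcond jumpE.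
split.
  apply/integrable_mkcond; first exact: measurable_mode.
  rewrite stepE; apply: integrable_sum => // j _.
  apply: integrable_sum => // b _.
  by have [] := GP j b.
rewrite integral_mkcond stepE integral_sum //; last first.
  by move=> j; apply: integrable_sum => // b _; have [] := GP j b.
apply: eq_bigr => j _; rewrite integral_sum //; last first.
  by move=> b; have [] := GP j b.
by apply: eq_bigr => b _; have [_ ->] := GP j b.
Qed.

Lemma integrable_sympow m :
  (forall k i j, mean_power_exists P sigma F law m k i j) ->
  forall k i a, P.-integrable (mode sigma k i)
     (fun w => (sympow m (trajectory x0 F k w) a 0)%:E).
Proof.
move=> hex; elim=> [|k IHk] i a; last first.
  by have [] := integral_sympow_step (hex k) IHk i a.
apply: (@finite_measure_integrable_cst _ _ _ _ _ (sympow m x0 a 0)).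
exact: measurable_mode.
Qed.

End JumpSystem.

Lemma lifted_stateE d (T : measurableType d) (R : realType) N n (x0 : 'cV[R]_n)
    (sigma : nat -> T -> 'I_N) (F : nat -> T -> 'M[R]_n) m k i a c w :
  lifted_state x0 sigma F m k w (mxtens_index (i, a)) c =
  (sigma k w == i)%:R * sympow m (trajectory x0 F k w) a 0.
Proof.
rewrite mxE mxtens_indexK; congr (_ * _); last first.
  by congr (sympow _ _ _ _); exact: ord1.
by rewrite mxE ord1 eqxx andbT eq_sym.
Qed.

Lemma sum_mxtens_index (V : nmodType) N q (f : 'I_(N * q) -> V) :
  \sum_r f r = \sum_i \sum_a f (mxtens_index (i, a)).
Proof.
rewrite pair_big (reindex (@mxtens_index N q)) /=.
  by apply: eq_bigr => -[].
exists (@mxtens_unindex N q) => r _; first exact: mxtens_indexK.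
exact: mxtens_unindexK.
Qed.

Theorem proposition3p8 (R : realType) (d : measure_display)
  (T : measurableType d) (P : probability T R) (N n m : nat)
  (p : 'M[R]_N) (s0 : 'I_N) (x0 : 'cV[R]_n)
  (sigma : nat -> T -> 'I_N) (F : nat -> T -> 'M[R]_n)
  (law : 'I_N -> 'I_N -> {measure set (borelM R n) -> \bar R})
  (hm : (0 < m)%N)
  (hsys : semi_markov_jump_system P p s0 sigma F law)
  (hpos : positive_system P F law)
  (hex : forall k i j, mean_power_exists P sigma F law m k i j)
  (k0 : nat) :
  let Fm := moment_mx P p sigma F law m k0 in
  [/\ mx_nonneg Fm,
      forall k, mx_integrable P (lifted_state x0 sigma F m k) setT &
      forall k, mx_expectation P (lifted_state x0 sigma F m k.+1) =
                Fm *m mx_expectation P (lifted_state x0 sigma F m k)].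
Proof.
move=> Fm.
pose law_power i j a b : \bar R :=
  (\int[law i j]_A (sympow_mx m (A : 'M[R]_n) a b)%:E)%E.
have FmE i a j b :
    Fm (mxtens_index (i, a)) (mxtens_index (j, b)) = fine (law_power j i a b).
  rewrite mxE !mxtens_indexK.
  by have [_ ->] := moment_blockE hsys a b (hex k0 j i).
have law_fin j i a b : law_power j i a b \is a fin_num.
  have [ilaw _] := moment_blockE hsys a b (hex k0 j i).
  by apply: integrable_fin_num.
pose state k i a : \bar R :=
  (\int[P]_(w in mode sigma k i) (sympow m (trajectory x0 F k w) a 0)%:E)%E.
have liftedE k i a c : (fun w => (lifted_state x0 sigma F m k w
    (mxtens_index (i, a)) c)%:E) =
    (fun w => (sympow m (trajectory x0 F k w) a 0)%:E) \_ (mode sigma k i).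
  apply/funext => w; rewrite (restrict_boolE (b := fun w => sigma k w == i)).
    by rewrite lifted_stateE.
  by move=> w'; split => /eqP.
have istate := integrable_sympow x0 hsys hex.
have state_fin k i a : state k i a \is a fin_num.
  by apply: integrable_fin_num; [exact: (measurable_mode hsys)|exact: istate].
have expectE k i a c : mx_expectation P (lifted_state x0 sigma F m k)
    (mxtens_index (i, a)) c = fine (state k i a).
  by rewrite mxE unlock liftedE -integral_mkcond.
split.
- move=> r c; have [i a] := mxtens_indexP r; have [j b] := mxtens_indexP c.
  rewrite FmE; apply: integral_law_ge0; exact: hpos.2.
- move=> k r c; have [i a] := mxtens_indexP r; rewrite liftedE.
  exact/(integrable_mkcond _ (measurable_mode hsys k i))/istate.
- move=> k; apply/matrixP => r c; have [i a] := mxtens_indexP r.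
  rewrite expectE mxE.
  have [_ step] := integral_sympow_step hsys (hex k) (istate k) i a.
  rewrite /state step sum_mxtens_index -[RHS]/(fine (_%:E)) -sumEFin.
  congr fine; apply: eq_bigr => j _; rewrite -sumEFin.
  apply: eq_bigr => b _; rewrite FmE expectE EFinM !fineK //; exact: state_fin.
Qed.
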